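(* Let $D$ be a finite simple digraph of order $n$, with minimum out-degree $k=\delta^+(D)\ge 1$ and (directed) girth $g=g(D)$. Suppose that $g\ge k$ and that $D$ contains no directed cycle of even length less than $2g$. Then $D$ satisfies the Caccetta--H\''{a}ggkvist conjecture, i.e. $D$ contains a directed cycle of length at most $\lceil n/k\rceil$; equivalently, $g\le \lceil n/k\rceil$.
   Context: A digraph is simple if it has no parallel arcs (pairs of opposite arcs $uv$, $vu$ are allowed). All cycles are directed cycles, and the girth $g(D)$ is the length of a shortest directed cycle in $D$. $\delta^+(D)$ denotes the minimum out-degree of a vertex of $D$. *)

(* Defs.v *)
From mathcomp Require Import all_boot.
Set Implicit Arguments. Unset Strict Implicit. Unset Printing Implicit Defensive.

(* A digraph on a finite vertex type V is given by its arc relation e : rel V.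
   A relation cannot have parallel arcs; "simple" additionally means no loops
   (irreflexive).  Opposite arcs uv, vu are allowed. *)
Definition loopless (V : finType) (e : rel V) : Prop := forall v, ~~ e v v.

Definition outdeg (V : finType) (e : rel V) (v : V) : nat := #|[set w | e v w]|.

(* minimum out-degree delta^+(D) (requires V nonempty to be meaningful) *)
Definition min_outdeg (V : finType) (e : rel V) : nat :=
  \big[minn/#|V|]_(v : V) outdeg e v.

Definition has_dcycle (V : finType) (e : rel V) (l : nat) : Prop :=
  exists s : seq V, [/\ size s = l, 0 < l, uniq s & cycle e s].

Definition is_girth (V : finType) (e : rel V) (g : nat) : Prop :=
  has_dcycle e g /\ (forall l, has_dcycle e l -> g <= l).

Definition ceil_div (n k : nat) : nat := (n + k - 1) %/ k.

(* Main.v *)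
Require Import Defs.
From mathcomp Require Import all_boot zify.
Set Implicit Arguments. Unset Strict Implicit. Unset Printing Implicit Defensive.

(** In the bipartite double cover every closed walk projects to a closed walk of
    even length, which has length at least 2g: a closed walk that is not a cycle
    splits into two, each of length at least g.  So it is enough to show that a
    2-coloured digraph with all out-degrees at least k and all closed walks of
    length at least 2g >= 2k has more than k(2g - 2) vertices.

    Induction on k, in a terminal strong component.  Averaging gives an arc
    u -> w with indeg u + indeg w >= 2k.  Let w = c_0, ..., c_L = u be a geodesic,
    and delete the in-neighbours of u and of w together with 2(g - 2) vertices of
    the geodesic, at least 2k + 2g - 4 vertices in all.  A vertex that loses at
    least two out-neighbours gets new ones: those of w if it had a walk of length
    2 to w, those of u if it had a walk of length 2 to u, and those of c_(i+1) if
    it had arcs to c_i and to some c_j with i + 2 <= j.  Each out-degree drops by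
    at most 1.  Measured by the position on the geodesic, every shortcut either
    moves forward without gaining length, or moves backward and gains at most 2
    on a closed walk of length at least 2g, so that closed walks keep length at
    least 2(g - 1), and induction applies to k - 1 and g - 1. *)

Fixpoint walk (T : finType) (e : rel T) n x y :=
  if n is m.+1 then [exists z, e x z && walk e m z y] else x == y.

Lemma walk1 (T : finType) (e : rel T) x y : e x y -> walk e 1 x y.
Proof. by move=> exy; apply/existsP; exists y; rewrite exy eqxx. Qed.

Lemma walk_cat (T : finType) (e : rel T) m n x y z :
  walk e m x y -> walk e n y z -> walk e (m + n) x z.
Proof.
elim: m x => [|m IHm] x /= => [/eqP-> //|/existsP[t /andP[ext wt]] wy].
by apply/existsP; exists t; rewrite ext IHm.
Qed.

Lemma walk_split (T : finType) (e : rel T) m n x z :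
  walk e (m + n) x z -> exists2 y, walk e m x y & walk e n y z.
Proof.
elim: m x => [|m IHm] x /=; first by move=> wx; exists x.
case/existsP=> t /andP[ext /IHm[y wty wyz]]; exists y => //.
by apply/existsP; exists t; rewrite ext.
Qed.

Lemma walkP (T : finType) (e : rel T) n x y :
  reflect (exists c : nat -> T,
    [/\ c 0 = x, c n = y & forall i, i < n -> e (c i) (c i.+1)]) (walk e n x y).
Proof.
apply: (iffP idP) => [|[c [<- <- ec]]].
  elim: n x => [|n IHn] x /=; first by move/eqP->; exists (fun=> y).
  case/existsP=> z /andP[exz /IHn[c [c0 cn ec]]].
  by exists (fun i => if i is j.+1 then c j else x); split=> // -[|i] ltin /=; [rewrite c0 | exact: ec].
elim: n ec => [|n IHn] ec; first exact: eqxx.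
rewrite -[X in walk _ X]addn1; apply: (@walk_cat _ _ _ _ _ (c n)).
  by apply: IHn => i ltin; apply/ec/leqW.
exact/walk1/ec.
Qed.

Lemma sub_walk (T : finType) (e e' : rel T) n x y :
  subrel e e' -> walk e n x y -> walk e' n x y.
Proof.
by move=> see' /walkP[c [<- <- ec]]; apply/walkP; exists c; split=> // i /ec/see'.
Qed.

Lemma connect_walk (T : finType) (e : rel T) x y :
  connect e x y -> exists n, walk e n x y.
Proof.
case/connectP=> p; elim: p x => [|z p IHp] x /=; first by move=> _ ->; exists 0; exact: eqxx.
case/andP=> exz /IHp wz /wz[n wn]; exists n.+1.
by apply/existsP; exists z; rewrite exz.
Qed.

Lemma walk_col (T : finType) (e : rel T) (col : pred T) n x y :
  (forall x y, e x y -> col y = ~~ col x) ->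
  walk e n x y -> col y = col x (+) odd n.
Proof.
move=> ecol; elim: n x => [|n IHn] x /=; first by move/eqP->; rewrite addbF.
case/existsP=> z /andP[/ecol colz /IHn coly].
by rewrite coly colz /= addNb addbN.
Qed.

(* Average [indeg u + indeg w] over the arcs [u -> w]. *)
Lemma heavy_arc (T : finType) (e : rel T) (A : {set T}) k :
  0 < k -> A != set0 -> (forall x y, e x y -> (x \in A) && (y \in A)) ->
  (forall x, x \in A -> k <= #|[set y | e x y]|) ->
  exists u w, e u w /\ 2 * k <= #|[set x | e x u]| + #|[set x | e x w]|.
Proof.
move=> k_gt0 A_n0 eA degA.
pose d x := \sum_y e x y; pose d' y := \sum_x e x y.
have dE x : d x = #|[set y | e x y]|.
  by rewrite -sum1_card big_mkcond; apply: eq_bigr => y _; rewrite inE; case: (e x y).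
have d'E y : d' y = #|[set x | e x y]|.
  by rewrite -sum1_card big_mkcond; apply: eq_bigr => x _; rewrite inE; case: (e x y).
have [/existsP[u /existsP[w /andP[euw leuw]]]|no] :=
    boolP [exists u, exists w, e u w && (2 * k <= d' u + d' w)].
  by exists u, w; rewrite -!d'E.
have light u w : e u w -> d' u + d' w < 2 * k.
  move=> euw; rewrite ltnNge; apply: contra no => leuw.
  by apply/existsP; exists u; apply/existsP; exists w; rewrite euw.
pose m := \sum_x d x.
have mE : m = \sum_y d' y by rewrite /m /d exchange_big.
have lem : \sum_u \sum_w e u w * (d' u + d' w) <= (2 * k - 1) * m.
  rewrite /m big_distrr /=; apply: leq_sum => u _; rewrite /d big_distrr /=.
  apply: leq_sum => w _; case: (boolP (e u w)) => [/light|_]; rewrite ?mul0n //; lia.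
have splitS : \sum_u \sum_w e u w * (d' u + d' w) = \sum_u (d u * d' u + d' u * d' u).
  rewrite big_split /=.
  have -> : \sum_u d' u * d' u = \sum_u \sum_w e u w * d' w.
    by rewrite exchange_big /=; apply: eq_bigr => u _; rewrite -big_distrl.
  rewrite -big_split /=; apply: eq_bigr => u _; rewrite /d big_distrl /= -big_split /=.
  by apply: eq_bigr => w _; rewrite mulnDr.
have out0 x : x \notin A -> d x = 0 /\ d' x = 0.
  move=> xA; split; apply: big1 => y _; case: (boolP (e _ _)) => // /eA.
    by rewrite (negPf xA).
  by rewrite (negPf xA) andbF.
have ge3 : 3 * k * \sum_y d' y <= \sum_u (d u * d' u + d' u * d' u) + k * \sum_x d x.
  rewrite !big_distrr /= -big_split /=; apply: leq_sum => x _.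
  have [/degA|/out0[-> ->]] := boolP (x \in A); last by lia.
  rewrite -dE => led; have := leq_mul led (leqnn (d' x)).
  have := leq_mul (leqnn k) led; have := (nat_Cauchy k (d' x)).1.
  by rewrite -!mulnn -mulnA; lia.
rewrite -mE -/m in ge3.
have m_gt0 : 0 < m.
  case/set0Pn: A_n0 => x xA; rewrite /m (bigD1 x) //= dE.
  by have := degA x xA; lia.
nia.
Qed.

Section Surgery.

Variables (T : finType) (e : rel T) (L : nat) (c : nat -> T).
Hypotheses (c_arc : forall i, i < L -> e (c i) (c i.+1))
           (c_geo : forall n, walk e n (c 0) (c L) -> L <= n).

Lemma walk_geo i j : i <= j <= L -> walk e (j - i) (c i) (c j).
Proof.
case/andP=> leij lejL; apply/walkP; exists (fun m => c (i + m)); split=> //.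
- by rewrite addn0.
- by rewrite subnKC.
- by move=> m ltm; rewrite addnS; apply: c_arc; lia.
Qed.

Lemma geo_forward l j h : l <= L -> j <= L -> walk e h (c l) (c j) -> j <= l + h.
Proof.
move=> leL lejL wh; suff: L <= l + h + (L - j) by lia.
have wl := @walk_geo 0 l leL; rewrite subn0 in wl.
by apply/c_geo/(walk_cat (walk_cat wl wh))/walk_geo; rewrite lejL leqnn.
Qed.

Lemma geo_inj i j : i <= L -> j <= L -> c i = c j -> i = j.
Proof.
move=> leiL lejL cij; have w0 : walk e 0 (c i) (c j) by apply/eqP.
have w0' : walk e 0 (c j) (c i) by apply/eqP.
by have := geo_forward leiL lejL w0; have := geo_forward lejL leiL w0'; lia.
Qed.

Variable g : nat.
Hypothesis e_girth : forall n x, 0 < n -> walk e n x x -> 2 * g <= n.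

Lemma geo_backward l j h :
  l <= L -> j <= l -> 0 < h -> walk e h (c l) (c j) -> 2 * g + j <= h + l.
Proof.
move=> lelL lejl h_gt0 wh.
have := @e_girth (h + (l - j)) (c l); rewrite addn_gt0 h_gt0 => /(_ isT).
have /walk_geo wjl : j <= l <= L by rewrite lejl.
by move/(_ (walk_cat wh wjl)); lia.
Qed.

Hypothesis c_back : e (c L) (c 0).

Lemma girth_le_geo : 2 * g <= L.+1.
Proof.
apply: (@e_girth _ (c 0)) => //; rewrite -addn1; apply: walk_cat (walk1 c_back).
by have := @walk_geo 0 L; rewrite subn0; apply; rewrite leq0n leqnn.
Qed.

Variable col : pred T.
Hypothesis e_col : forall x y, e x y -> col y = ~~ col x.

Lemma col_geo i : i <= L -> col (c i) = col (c 0) (+) odd i.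
Proof.
move=> leiL; apply: (walk_col e_col (n := i)).
by have := @walk_geo 0 i; rewrite subn0; apply.
Qed.

Lemma odd_geo : odd L.
Proof.
by have := e_col c_back; rewrite (col_geo (leqnn L)); case: (col _); case: (odd L).
Qed.

Lemma geo_arc i j : i <= L -> j <= L -> e (c i) (c j) ->
  [/\ odd j = ~~ odd i, j <= i.+1 & j <= i -> 2 * g + j <= i.+1].
Proof.
move=> leiL lejL eij; have wij := walk1 eij; split.
- have := e_col eij; rewrite (col_geo leiL) (col_geo lejL).
  by case: (col _); case: (odd i); case: (odd j).
- by have := geo_forward leiL lejL wij; rewrite addn1.
- by move=> leji; apply: geo_backward wij.
Qed.

Hypothesis g_gt1 : 1 < g.

(* The levels of the vertices removed from the geodesic: far enough from both
   ends, and of alternating parity, that [rail] is disjoint from the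
   in-neighbourhoods of the ends and from the out-neighbourhood of [c L]. *)
Definition rung i :=
  odd i && (i + 5 <= 2 * g) || [&& ~~ odd i, L + 3 <= i + 2 * g & i + 3 <= L].

Definition rail : {set T} := [set c i | i : 'I_L & rung i].

Definition removed : {set T} := [set x | e x (c 0)] :|: [set x | e x (c L)] :|: rail.

Lemma railP x : reflect (exists2 i, rung i & x = c i) (x \in rail).
Proof.
apply: (iffP imsetP) => [[i]|[i ri ->]]; first by rewrite inE => ri ->; exists i.
have ltiL : i < L by move: ri girth_le_geo; rewrite /rung; lia.
by exists (Ordinal ltiL); rewrite ?inE.
Qed.

Lemma rung_lt i : rung i -> i + 3 <= L.
Proof. by move: girth_le_geo; rewrite /rung; lia. Qed.

Lemma card_rail : 2 * (g - 2) <= #|rail|.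
Proof.
have := girth_le_geo; have := odd_geo => oL gL.
pose f (s : 'I_(g - 2)) := c (s.*2.+1); pose h (s : 'I_(g - 2)) := c (L - 3 - s.*2).
have injf : injective f.
  by move=> [s lts] [t ltt] /geo_inj E; apply/val_inj => /=; have := E; move=> /=; lia.
have injh : injective h.
  by move=> [s lts] [t ltt] /geo_inj E; apply/val_inj => /=; have := E; move=> /=; lia.
have dis : [disjoint f @: 'I_(g - 2) & h @: 'I_(g - 2)].
  apply/pred0P => x /=; apply/negP => /andP[/imsetP[[s lts] _ ->] /imsetP[[t ltt] _]].
  by move/geo_inj => /= E; have := E; lia.
have sub : f @: 'I_(g - 2) :|: h @: 'I_(g - 2) \subset rail.
  apply/subsetP => x /setUP[] /imsetP[[s lts] _ ->]; apply/railP.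
    by exists (s.*2.+1) => //; rewrite /rung /=; lia.
  by exists (L - 3 - s.*2) => //; rewrite /rung /=; lia.
have := subset_leq_card sub; rewrite cardsU (disjoint_setI0 dis) cards0 subn0.
by rewrite (card_imset _ injf) (card_imset _ injh) card_ord; lia.
Qed.

Lemma card_removed :
  #|[set x | e x (c L)]| + #|[set x | e x (c 0)]| + 2 * (g - 2) <= #|removed|.
Proof.
have := girth_le_geo => gL.
have I1 : [set x | e x (c 0)] :&: [set x | e x (c L)] = set0.
  apply/setP => x; rewrite !inE; apply/negP => /andP[/e_col cx0 /e_col].
  by rewrite (col_geo (leqnn L)) odd_geo cx0; case: (col x).
have I2 : ([set x | e x (c 0)] :|: [set x | e x (c L)]) :&: rail = set0.
  apply/setP => x; rewrite !inE; apply/negP => /andP[ex /railP[i ri xi]].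
  have lti := rung_lt ri; move: ex; rewrite xi => /orP[] /geo_arc.
    by case; [lia | lia | move=> + _ /(_ isT); move: ri; rewrite /rung; lia].
  by case; [lia | lia | lia].
rewrite /removed cardsU I2 cards0 subn0 cardsU I1 cards0 subn0.
by have := card_rail; lia.
Qed.

(* All three detours from [y] to [c l] have length 2, so the new arcs respect the
   colouring.  In the third one the arc to [c j], at least two levels further up,
   makes up for the shortcut. *)
Definition departs (y : T) (l : nat) :=
  [|| (l == 0) && [exists r, e y r && e r (c 0)],
      (l == L) && [exists r, e y r && e r (c L)] |
      [exists i : 'I_L, exists j : 'I_L,
         [&& l == i.+1, i.+2 <= j, j.+3 <= L, e y (c i) & e y (c j)]]].

Definition surgery : rel T := fun y z =>
  [&& y \notin removed, z \notin removed &
      e y z || [exists l : 'I_L.+1, departs y l && e (c l) z]].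

Lemma departsP y l : departs y l ->
  [\/ l = 0 /\ (exists2 r, e y r & e r (c 0)),
      l = L /\ (exists2 r, e y r & e r (c L)) |
      exists i j, [/\ l = i.+1, i.+2 <= j, j.+3 <= L, e y (c i) & e y (c j)]].
Proof.
case/or3P=> [/andP[/eqP-> /existsP[r /andP[]]] | /andP[/eqP-> /existsP[r /andP[]]] |].
- by move=> yr r0; constructor 1; split=> //; exists r.
- by move=> yr r0; constructor 2; split=> //; exists r.
- case/existsP=> i /existsP[j /and5P[/eqP-> ? ? ? ?]].
  by constructor 3; exists (nat_of_ord i), (nat_of_ord j).
Qed.

(* The position potential: [c L] counts 2 less, because arriving there uses a
   walk of length 2 that the new arc bypasses. *)
Definition level (l : nat) := l - 2 * (l == L).

Lemma departs_level y l h l' : l <= L -> 0 < h -> walk e h (c l) y -> departs y l' ->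
  level l' <= h + level l /\ (l' <= l -> level l' + (2 * g - 2) <= h + level l).
Proof.
move=> lelL h_gt0 wh; have gL := girth_le_geo.
have wh1 z : e y z -> walk e h.+1 (c l) z.
  by move=> yz; rewrite -addn1; apply: walk_cat wh (walk1 yz).
have wh2 r z : e y r -> e r z -> walk e h.+2 (c l) z.
  by move=> yr rz; rewrite -addn1; apply: walk_cat (wh1 _ yr) (walk1 rz).
case/departsP=> [[-> [r yr r0]] | [-> [r yr rL]] | [i [j [-> leij ltjL yi yj]]]].
- have := geo_backward lelL (leq0n l) (ltn0Sn _) (wh2 _ _ yr r0).
  by rewrite /level; lia.
- have := geo_forward lelL (leqnn L) (wh2 _ _ yr rL).
  have back leLl := geo_backward lelL leLl (ltn0Sn _) (wh2 _ _ yr rL).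
  by rewrite /level; lia.
- have iL : i <= L by lia.
  have jL : j <= L by lia.
  have := geo_forward lelL iL (wh1 _ yi); have := geo_forward lelL jL (wh1 _ yj).
  have backi leil := geo_backward lelL leil (ltn0Sn _) (wh1 _ yi).
  have backj lejl := geo_backward lelL lejl (ltn0Sn _) (wh1 _ yj).
  by rewrite /level; lia.
Qed.

Lemma surgery_walk n l z x : l <= L -> e (c l) z -> walk surgery n z x ->
  exists l' h, [/\ l' <= L, 0 < h, walk e h (c l') x &
    h + level l' <= n.+1 + level l /\
    (l' < l -> h + level l' + (2 * g - 2) <= n.+1 + level l)].
Proof.
move=> lelL elz; elim: n x => [|n IHn] x.
  by move/eqP <-; exists l, 1; split=> //; [exact: walk1 | lia].
rewrite -addn1 => /walk_split[y wy /existsP[x' /andP[yx /eqP <-]]].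
have [l' [h [lel'L h_gt0 wh leh]]] := IHn _ wy.
case/and3P: yx => _ _ /orP[yx | /existsP[l'' /andP[dep ex]]].
  exists l', (h + 1); split=> //; first by rewrite addn1.
    exact: walk_cat wh (walk1 yx).
  by move: leh; lia.
exists l'', 1; split=> //; [by rewrite -ltnS | exact: walk1 |].
have [d1 d2] := departs_level lel'L h_gt0 wh dep; case: leh => leh1 leh2.
split=> [|ltl]; first lia.
have [/d2 | ltl'] := leqP l'' l'; first lia.
by have := leh2 (ltn_trans ltl' ltl); lia.
Qed.

Lemma surgery_col x y : surgery x y -> col y = ~~ col x.
Proof.
case/and3P=> _ _ /orP[/e_col // | /existsP[l /andP[/departsP dep ly]]].
case: dep => [[El [r xr r0]] | [El [r xr rL]] | [i [j [El leij ltjL xi _]]]].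
- by move: ly; rewrite El => /e_col->; rewrite (e_col r0) (e_col xr); case: (col x).
- by move: ly; rewrite El => /e_col->; rewrite (e_col rL) (e_col xr); case: (col x).
- have ii : e (c i) (c i.+1) by apply: c_arc; move: leij ltjL; clear; lia.
  by move: ly; rewrite El => /e_col->; rewrite (e_col ii) (e_col xi); case: (col x).
Qed.

Lemma surgery_sub x y : surgery x y -> (exists z, e x z) /\ (exists z, e z y).
Proof.
case/and3P=> _ _ /orP[xy | /existsP[l /andP[/departsP dep ly]]]; first by split; eexists; exact: xy.
split; last by exists (c l).
by case: dep => [[_ [r xr _]] | [_ [r xr _]] | [i [_ [_ _ _ xi _]]]]; eexists; eassumption.
Qed.

Lemma surgery_new n x y : walk surgery n x y ->
  walk e n x y \/ exists a b l n1 n2, [/\ n = n1 + n2.+1, walk surgery n1 x a,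
    departs a l, l <= L & e (c l) b /\ walk surgery n2 b y].
Proof.
elim: n x => [|n IHn] x; first by left.
case/existsP=> z /andP[xz wzy].
case/and3P: (xz) => _ _ /orP[exz | /existsP[l /andP[dep lz]]]; last first.
  right; exists x, z, l, 0, n; split=> //; first exact: eqxx.
  by rewrite -ltnS.
case: (IHn z wzy) => [ewzy | [a [b [l [n1 [n2 [-> wza dep lel rest]]]]]]].
  by left; apply/existsP; exists z; rewrite exz.
right; exists a, b, l, n1.+1, n2; split=> //.
by apply/existsP; exists z; rewrite xz.
Qed.

Lemma surgery_girth n x : 0 < n -> walk surgery n x x -> 2 * g.-1 <= n.
Proof.
move=> n_gt0 /surgery_new[/e_girth-/(_ n_gt0)|]; first by lia.
case=> a [b [l [n1 [n2 [-> wxa dep lelL [lb wbx]]]]]].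
have [l' [h [lel'L h_gt0 wh [leh1 leh2]]]] := surgery_walk lelL lb (walk_cat wbx wxa).
have [d1 d2] := departs_level lel'L h_gt0 wh dep.
by have [/d2 | /leh2] := leqP l l'; lia.
Qed.

Lemma geo_supply k l : k < #|[set z | e (c l) z]| ->
  [\/ l = 0, l = L | exists2 i, l = i.+1 & rung i && rung i.+2] ->
  k <= #|[set z | e (c l) z] :\: removed|.
Proof.
move=> degl Hl; have gL := girth_le_geo; have oL := odd_geo.
have lelL : l <= L by case: Hl => [->|->|[i -> /andP[_ /rung_lt]]] //; lia.
suff sub : [set z | e (c l) z] :&: removed \subset [set c l.+1].
  have := cardsID removed [set z | e (c l) z]; have := subset_leq_card sub.
  by rewrite cards1; lia.
apply/subsetP => z; rewrite !inE -orbA => /andP[lz /or3P[z0 | zL | /railP[j rj zj]]].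
- have w0 : walk e 2 (c l) (c 0) := walk_cat (walk1 lz) (walk1 z0).
  have := geo_backward lelL (leq0n l) (ltn0Sn _) w0.
  have := e_col z0; rewrite (e_col lz) (col_geo lelL).
  case: Hl => [->|->|[i -> /andP[]]]; rewrite ?oL /=; [lia | by case: (col _) |].
  by rewrite /rung /=; case: (odd i); [lia | case: (col _)].
- have wL : walk e 2 (c l) (c L) := walk_cat (walk1 lz) (walk1 zL).
  have back leLl := geo_backward lelL leLl (ltn0Sn _) wL; have := geo_forward lelL (leqnn L) wL.
  case: Hl => [->|El|[i -> /andP[_ /rung_lt]]]; [lia | | lia].
  by move: back; rewrite El leqnn => /(_ isT); lia.
- have ltj := rung_lt rj; have lejL : j <= L by lia.
  move: lz; rewrite zj => /(geo_arc lelL lejL)[oj lej back].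
  suff -> : j = l.+1 by [].
  move: oj lej back rj; case: Hl => [->|->|[i -> /andP[]]]; rewrite /rung; lia.
Qed.

Lemma surgery_deg k y : (forall i, i <= L -> k < #|[set z | e (c i) z]|) ->
  y \notin removed -> k < #|[set z | e y z]| ->
  k <= #|[set z | surgery y z]|.
Proof.
move=> c_deg yU degy; have gL := girth_le_geo.
have new l : l <= L -> departs y l ->
  [\/ l = 0, l = L | exists2 i, l = i.+1 & rung i && rung i.+2] ->
  k <= #|[set z | surgery y z]|.
  move=> lelL dep /(geo_supply (c_deg _ lelL)) /leq_trans; apply; apply: subset_leq_card.
  apply/subsetP => z /setDP[lz zU]; rewrite inE in lz.
  rewrite inE /surgery yU zU /=; apply/orP; right; apply/existsP.
  by exists (Ordinal (lelL : l < L.+1)); rewrite dep.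
have [/existsP[r /andP[yr r0]] | no0] := boolP [exists r, e y r && e r (c 0)].
  apply: (new 0) => //; last by constructor 1.
  by apply/orP; left; rewrite eqxx; apply/existsP; exists r; rewrite yr.
have [/existsP[r /andP[yr rL]] | noL] := boolP [exists r, e y r && e r (c L)].
  apply: (new L) => //; last by constructor 2.
  by apply/or3P/Or32; rewrite eqxx; apply/existsP; exists r; rewrite yr.
have [few | many] := leqP #|[set z | e y z] :&: removed| 1.
  have sub : [set z | e y z] :\: removed \subset [set z | surgery y z].
    apply/subsetP => z /setDP[yz zU]; rewrite inE in yz.
    by rewrite inE /surgery yU zU yz.
  have := cardsID removed [set z | e y z]; have := subset_leq_card sub.
  by lia.
have inrail z : z \in [set z | e y z] :&: removed -> e y z /\ z \in rail.
  rewrite !inE -orbA => /andP[yz /or3P[z0 | zL | //]]; split=> //.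
    by case/existsP: no0; exists z; rewrite yz.
  by case/existsP: noL; exists z; rewrite yz.
have [z1 [z2 [/inrail[yz1 /railP[i ri E1]] /inrail[yz2 /railP[j rj E2]] z12]]] := card_gt1P many.
wlog ltij : i j z1 z2 yz1 yz2 ri rj E1 E2 z12 / i < j.
  move=> W; case: (ltngtP i j) => [lt|lt|eq]; first exact: (W i j z1 z2).
    by apply: (W j i z2 z1) => //; rewrite eq_sym.
  by rewrite E1 E2 eq eqxx in z12.
subst z1 z2; have lti := rung_lt ri; have ltj := rung_lt rj.
have oij : odd i = odd j.
  have := e_col yz1; rewrite -(e_col yz2) (@col_geo i) ?(@col_geo j); [|lia|lia].
  by case: (col _); case: (odd i); case: (odd j).
have leij : i.+2 <= j by lia.
apply: (new i.+1); first lia; last first.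
  by constructor 3; exists i => //; rewrite ri; move: ri rj; rewrite /rung /=; lia.
have iL : i < L by lia.
have jL : j < L by lia.
apply/or3P/Or33/existsP; exists (Ordinal iL); apply/existsP; exists (Ordinal jL).
by rewrite /= eqxx leij yz1 yz2; lia.
Qed.

End Surgery.

Lemma strong_core (T : finType) (e : rel T) (A : {set T}) :
  A != set0 -> (forall x y, e x y -> y \in A) ->
  exists K : {set T}, [/\ K \subset A, K != set0,
    forall x y, e x y -> x \in K -> y \in K & {in K &, forall x y, connect e x y}].
Proof.
case/set0Pn=> v0 v0A eA; pose reach v := [set y | connect e v y].
case: (arg_minnP (fun v => #|reach v|) v0A) => v vA minv.
have KA : reach v \subset A.
  apply/subsetP => y; rewrite inE => /connectP[p]; elim/last_ind: p y => [|p z _] y.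
    by move=> _ ->.
  by rewrite rcons_path last_rcons => /andP[_ /eA zA] ->.
exists (reach v); split=> //.
- by apply/set0Pn; exists v; rewrite inE connect0.
- by move=> x y exy; rewrite !inE => /connect_trans; apply; apply: connect1.
move=> x y xK yK; have sub : reach x \subset reach v.
  by apply/subsetP => z; move: xK; rewrite !inE; apply: connect_trans.
suff E : reach x = reach v by move: yK; rewrite -E inE.
by apply/eqP; rewrite eqEcard sub; apply/minv/(subsetP KA).
Qed.

Lemma colored_bound (T : finType) (col : pred T) k g (e : rel T) (A : {set T}) :
  k <= g -> A != set0 ->
  (forall x y, e x y -> (x \in A) && (y \in A)) ->
  (forall x y, e x y -> col y = ~~ col x) ->
  (forall x, x \in A -> k <= #|[set y | e x y]|) ->
  (forall n x, 0 < n -> walk e n x x -> 2 * g <= n) ->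
  k * (2 * g - 2) < #|A|.
Proof.
elim: k g e A => [|k IHk] g e A lekg A_n0 eA e_col degA girth; first by rewrite mul0n card_gt0.
have [|K [KA K_n0 eK conK]] := @strong_core T e A A_n0; first by move=> x y /eA/andP[].
apply: leq_trans (subset_leq_card KA).
pose f : rel T := fun x y => e x y && (x \in K).
have fe : subrel f e by move=> x y /andP[].
have fK x y : f x y -> (x \in K) && (y \in K).
  by case/andP=> exy xK; rewrite xK (eK _ _ exy).
have f_col x y : f x y -> col y = ~~ col x by move/fe/e_col.
have f_girth n x : 0 < n -> walk f n x x -> 2 * g <= n.
  by move=> n_gt0 /(sub_walk fe)/girth; apply.
have degK x : x \in K -> k < #|[set y | f x y]|.
  move=> xK; have := degA x (subsetP KA x xK); congr (_ <= _); apply: eq_card => y.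
  by rewrite !inE /f xK andbT.
have fcon x y : x \in K -> connect e x y -> connect f x y.
  move=> + /connectP[p]; elim: p x => [|z p IHp] x xK /=; first by move=> _ ->.
  case/andP=> exz /IHp IH /IH; move/(_ (eK _ _ exz xK)); apply: connect_trans.
  by apply: connect1; rewrite /f exz.
have [u [w [fuw heavy]]] := heavy_arc (ltn0Sn k) K_n0 fK degK.
have [uK wK] := andP (fK _ _ fuw).
have exwalk : exists n, walk f n w u by apply/connect_walk/fcon/conK.
case: (ex_minnP exwalk) => L /walkP[c [c0 cL c_arc]] minL.
have c_geo n : walk f n (c 0) (c L) -> L <= n by rewrite c0 cL; apply: minL.
have c_back : f (c L) (c 0) by rewrite c0 cL.
have cK i : i <= L -> c i \in K.
  by elim: i => [|i IHi] leiL; [rewrite c0 | have /andP[] := fK _ _ (c_arc _ leiL)].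
have gL : 2 * g <= L.+1 := girth_le_geo c_arc f_girth c_back.
have [k0 | k_gt0] := posnP k.
  have inj : injective (fun i : 'I_L.+1 => c i).
    move=> i j /(geo_inj c_arc c_geo) E; apply: val_inj; apply: E; rewrite -ltnS; apply: ltn_ord.
  have : [set c i | i : 'I_L.+1] \subset K.
    by apply/subsetP => _ /imsetP[i _ ->]; apply: cK; rewrite -ltnS.
  by move/subset_leq_card; rewrite (card_imset _ inj) card_ord; lia.
have g_gt1 : 1 < g by lia.
pose U := removed f L c g; pose f' := surgery f L c g.
have cdeg i : i <= L -> k < #|[set z | f (c i) z]| by move/cK/degK.
have cardU : #|[set x | f x u]| + #|[set x | f x w]| + 2 * (g - 2) <= #|U|.
  by rewrite -c0 -cL; apply: (card_removed c_arc c_geo f_girth c_back f_col).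
have B_n0 : K :\: U != set0.
  have supply := geo_supply c_arc c_geo f_girth c_back f_col g_gt1 (cdeg _ (leq0n L)).
  have /card_gt0P[z /setDP[zw zU]] := leq_trans k_gt0 (supply (Or31 _ _ (erefl 0))).
  apply/set0Pn; exists z; rewrite inE zU; move: zw; rewrite inE => /fK/andP[_ ->].
  by [].
have f'K x y : f' x y -> (x \in K :\: U) && (y \in K :\: U).
  move=> xy; have /and3P[xU yU _] := xy.
  have [[z /fK/andP[xK _]] [t /fK/andP[_ yK]]] := surgery_sub xy.
  by rewrite !in_setD xU yU xK yK.
have deg' x : x \in K :\: U -> k <= #|[set y | f' x y]|.
  case/setDP=> /degK degx xU.
  by apply: (surgery_deg c_arc c_geo f_girth c_back f_col g_gt1 cdeg xU degx).
have f'_col x y : f' x y -> col y = ~~ col x by exact: (surgery_col c_arc f_col).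
have f'_girth n x : 0 < n -> walk f' n x x -> 2 * g.-1 <= n.
  exact: (surgery_girth c_arc c_geo f_girth c_back).
have lekg' : k <= g.-1 by lia.
have := IHk g.-1 f' _ lekg' B_n0 f'K f'_col deg' f'_girth.
have UK : U \subset K.
  apply/subsetP => x; rewrite !inE -orbA => /or3P[/fK/andP[] // | /fK/andP[] // |].
  by case/imsetP=> i _ ->; apply/cK/ltnW.
have := cardsID U K; rewrite (setIidPr UK).
have -> : 2 * g - 2 = 2 * g.-1 - 2 + 2 by lia.
rewrite mulnDr mulSn; lia.
Qed.

Lemma closed_walk_bound (T : finType) (e : rel T) g n x :
  (forall l, has_dcycle e l -> g <= l) -> 0 < n -> walk e n x x ->
  has_dcycle e n \/ 2 * g <= n.
Proof.
move=> girth; elim/ltn_ind: n x => n IHn x n_gt0 /walkP[c [c0 cn ec]].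
have geg m y : m < n -> 0 < m -> walk e m y y -> g <= m.
  by move=> ltmn m_gt0 /(IHn m ltmn y m_gt0)[/girth | ]; lia.
have [us | /(uniqPn x)[i [j [ltij]]]] := boolP (uniq (mkseq c n)).
  left; exists (mkseq c n); split; rewrite ?size_mkseq //.
  have -> : mkseq c n = c 0 :: mkseq (c \o succn) n.-1.
    by rewrite -{1}(prednK n_gt0) /mkseq /= -[1]/(1 + 0) iotaDl -map_comp.
  have -> : cycle e (c 0 :: mkseq (c \o succn) n.-1) = path e (c 0) (mkseq (c \o succn) n).
    rewrite /= -[in RHS](prednK n_gt0) /mkseq -addn1 iotaD map_cat cats1 add0n /=.
    by rewrite (prednK n_gt0) cn c0.
  apply/(pathP x) => i; rewrite size_mkseq => lti; rewrite nth_mkseq //.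
  by case: i lti => [|i] lti /=; [exact: ec | rewrite nth_mkseq; [exact: ec | lia]].
rewrite size_mkseq => ltjn; rewrite !nth_mkseq; [|lia|lia] => cij; right.
have sub a b : a <= b <= n -> walk e (b - a) (c a) (c b).
  case/andP=> leab lebn; apply/walkP; exists (fun m => c (a + m)); split=> [||m ltm].
  - by rewrite addn0.
  - by rewrite subnKC.
  - by rewrite addnS; apply: ec; lia.
have w1 : walk e (j - i) (c i) (c i) by rewrite {2}cij; apply: sub; lia.
have w2 : walk e (n - j + (i - 0)) (c j) (c j).
  apply: (@walk_cat _ _ _ _ _ (c 0)); first by rewrite c0 -cn; apply: sub; lia.
  by rewrite -cij; apply: sub; lia.
have := geg _ _ _ _ w1; have := geg _ _ _ _ w2; lia.
Qed.

Definition double_cover (T : finType) (e : rel T) : rel (T * bool) :=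
  fun p q => e p.1 q.1 && (q.2 == ~~ p.2).

Lemma double_cover_girth (T : finType) (e : rel T) g n p :
  (forall l, has_dcycle e l -> g <= l) ->
  (forall l, has_dcycle e l -> ~~ odd l -> 2 * g <= l) ->
  0 < n -> walk (double_cover e) n p p -> 2 * g <= n.
Proof.
move=> girth even_girth n_gt0 wp.
have evn : ~~ odd n.
  have flip (x y : T * bool) : double_cover e x y -> y.2 = ~~ x.2 by case/andP=> _ /eqP.
  by have := walk_col (col := snd) flip wp; case: (p.2); case: (odd n).
have wp1 : walk e n p.1 p.1.
  case/walkP: wp => c [c0 cn ec]; apply/walkP; exists (fun i => (c i).1).
  by rewrite c0 cn; split=> // i /ec/andP[].
by case: (closed_walk_bound girth n_gt0 wp1) => // /even_girth; apply.
Qed.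

Lemma double_cover_outdeg (T : finType) (e : rel T) p :
  outdeg e p.1 <= #|[set q | double_cover e p q]|.
Proof.
have inj : injective (fun w : T => (w, ~~ p.2)) by move=> u w [].
rewrite /outdeg -(card_imset _ inj); apply/subset_leq_card/subsetP => q.
by case/imsetP=> w; rewrite inE => pw ->; rewrite inE /double_cover pw /=.
Qed.

Lemma min_outdeg_le (T : finType) (e : rel T) v : min_outdeg e <= outdeg e v.
Proof.
rewrite /min_outdeg; have := mem_index_enum v; elim: (index_enum T) => //= w r IHr.
rewrite big_cons inE => /orP[/eqP-> | /IHr]; first exact: geq_minl.
by apply: leq_trans; apply: geq_minr.
Qed.

Theorem theorem3p1 (V : finType) (e : rel V) (g : nat) :
  loopless e ->
  1 <= min_outdeg e ->
  is_girth e g ->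
  min_outdeg e <= g ->
  (forall l, has_dcycle e l -> ~~ odd l -> l < 2 * g -> False) ->
  g <= ceil_div #|V| (min_outdeg e).
Proof.
move=> _ k_gt0 [[s [sz_s g_gt0 _ _]] girth] lekg no_even.
have even_girth l : has_dcycle e l -> ~~ odd l -> 2 * g <= l.
  by move=> cl evl; rewrite leqNgt; apply/negP => /(no_even l cl evl).
have A_n0 : [set: V * bool] != set0.
  case: s sz_s => [|v s] sz_s; first by move: g_gt0; rewrite -sz_s.
  by apply/set0Pn; exists (v, true); rewrite inE.
have := @colored_bound _ (@snd V bool) _ g (double_cover e) _ lekg A_n0.
rewrite cardsT card_prod card_bool => bound.
have {bound} : min_outdeg e * (2 * g - 2) < #|V| * 2.
  apply: bound => [x y _ | x y /andP[_ /eqP] // | p _ | n p].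
  - by rewrite !inE.
  - exact: leq_trans (min_outdeg_le e p.1) (double_cover_outdeg e p).
  - exact: double_cover_girth.
rewrite mulnBr mulnCA => lt_n; rewrite /ceil_div leq_divRL //.
by move: lt_n; rewrite [g * _]mulnC; lia.
Qed.
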